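(* Assume that $\widetilde E$ is convex. Then the sequence $\{(\tilde u^{(n)},\lambda^{(n)})\}$ generated by the decoupled augmented Lagrangian method satisfies, for all $n\ge 0$, $$\|P_B(\tilde u^{(n)}-\tilde u^{(n+1)})\|_2^2+\frac1{\eta^2}\|\lambda^{(n)}-\lambda^{(n+1)}\|_2^2\le\frac1{n+1}\inf_{(\tilde u^*,\lambda^* )}\left(\|P_B(\tilde u^{(0)}-\tilde u^* )\|_2^2+\frac1{\eta^2}\|\lambda^{(0)}-\lambda^*\|_2^2\right),$$ where the infimum is taken over all critical points $(\tilde u^*,\lambda^* )$ of the saddle point problem $$\min_{\tilde u\in\widetilde V}\max_{\lambda\in\widetilde V^*}\left\{\widetilde E(\tilde u)+\langle J_{\widetilde V}(I-P_B)\tilde u,\lambda\rangle_{\widetilde V^*}+\frac{\eta}{2}\|(I-P_B)\tilde u\|_2^2\right\}.$$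
   Context: Let $\Omega=\{1,\dots,M\}\times\{1,\dots,N\}$ be a discrete image domain and $V$ the space of all functions $\Omega\to\mathbb R$ with the Euclidean inner product. Let $T:V\to V$ be an operator, and let $\Omega$ be partitioned into $\mathcal N$ disjoint rectangular subdomains $\Omega_1,\dots,\Omega_{\mathcal N}$. For $D\subset\Omega$, the essential domain $\mathrm{ed}_D(T)$ of $T$ on $D$ is the minimal subset $\tilde D\subset\Omega$ such that $T(u)|_D$ can be expressed with the values of $u|_{\tilde D}$ only. Put $\widetilde\Omega_s=\mathrm{ed}_{\Omega_s}(T)$; it is assumed that $\Omega_s\subset\widetilde\Omega_s$. Let $\widetilde V_s=\{v\in V:\operatorname{supp}v\subset\widetilde\Omega_s\}$ and $\widetilde V=\bigoplus_{s=1}^{\mathcal N}\widetilde V_s$ (external direct sum, Euclidean inner product). The local energies are $E_s(u)=\sum_{(i,j)\in\Omega_s}T(u)_{ij}$, and $\widetilde E:\widetilde V\to\mathbb R$ is $\widetilde E(\tilde u)=\sum_{s=1}^{\mathcal N}E_s(\tilde u_s)$ for $\tilde u=\bigoplus_s\tilde u_s$. The jump operator $B$ maps $\tilde u\in\widetilde V$ to the collection of functions $\tilde u_s|_{\widetilde\Gamma_{st}}-\tilde u_t|_{\widetilde\Gamma_{st}}$, $s<t$, where $\widetilde\Gamma_{st}=\widetilde\Omega_s\cap\widetilde\Omega_t$. $P_B:\widetilde V\to\widetilde V$ is the orthogonal projection onto $\ker B$, and $I$ is the identity. For a finite-dimensional Euclidean space $H$, $J_H:H\to H^*$ is the Riesz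 isomorphism $(J_Hu)(v)=\langle u,v\rangle_H$, $H^*$ carries the induced inner product and norm, and $J_{H^*}=J_H^{-1}:H^*\to H$. $\|\cdot\|_2$ denotes Euclidean norms. Decoupled augmented Lagrangian method: choose $\eta>0$, $\tilde u^{(0)}\in\widetilde V$ and $\lambda^{(0)}\in\widetilde V^*$ with $J_{\widetilde V^*}\lambda^{(0)}\in(\ker B)^\perp$. For $n=0,1,2,\dots$: for each $s$ set $\hat u_s^{(n+1)}=(P_B\tilde u^{(n)})_s-\frac1\eta J_{\widetilde V_s^*}\lambda_s^{(n)}$ and $$\tilde u_s^{(n+1)}\in\arg\min_{\tilde u_s\in\widetilde V_s}\left\{E_s(\tilde u_s)+\frac\eta2\|\tilde u_s-\hat u_s^{(n+1)}\|_2^2\right\};$$ set $\tilde u^{(n+1)}=\bigoplus_s\tilde u_s^{(n+1)}$ and $\lambda^{(n+1)}=\lambda^{(n)}+\eta J_{\widetilde V}(I-P_B)\tilde u^{(n+1)}$. Here $\lambda_s^{(n)}\in\widetilde V_s^*$ is the $s$-th component of $\lambda^{(n)}$. A critical point of the saddle point problem is a pair $(\tilde u^*,\lambda^* )\in\widetilde V\times\widetilde V^*$ with $(I-P_B)\tilde u^*=0$ and $\tilde u^*\in\arg\min_{\tilde u\in\widetilde V}\{\widetilde E(\tilde u)+\langle J_{\widetilde V}(I-P_B)\tilde u,\lambda^*\rangle_{\widetilde V^*}+\frac\eta2\|(I-P_B)\tilde u\|_2^2\}$. The infimum over the empty set is $+\infty$. *)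

(* Defs.v *)
From HB Require Import structures.
From mathcomp Require Import all_boot all_order all_algebra.
From mathcomp Require Import all_classical all_reals all_analysis.

Set Implicit Arguments.
Unset Strict Implicit.
Unset Printing Implicit Defensive.

Import Order.TTheory GRing.Theory Num.Theory.

Local Open Scope ring_scope.

Lemma linfunE (K : fieldType) (U W : vectType K) (f : U -> W) :
  linear f -> linfun f =1 f.
Proof.
move=> lf; pose g := HB.pack_for {linear U -> W} f
  (GRing.isLinear.Build K U W *:%R _ lf).
exact: (lfunE g).
Qed.

Section Euclidean.
Variables (R : rcfType) (H : vectType R) (ip : {dot H for idfun}).

Definition norm2 (u : H) : R := Num.sqrt (ip u u).

Definition riesz : 'Hom(H, 'Hom(H, R^o)) :=
  linfun (fun u : H => linfun (fun v : H => ip u v : R^o)).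

(* A true two-sided inverse, see [rieszK] and [riesz_invK]. *)
Definition riesz_inv : 'Hom('Hom(H, R^o), H) := (riesz^-1)%VF.

Definition ip_dual (l m : 'Hom(H, R^o)) : R := ip (riesz_inv l) (riesz_inv m).

(* Projection onto [W] along [orthov ip W]; see [orth_projP]. *)
Definition orth_proj (W : {vspace H}) : 'End(H) := daddv_pi W (orthov ip W).

Lemma ipC u v : ip u v = ip v u.
Proof. by rewrite hermC expr0 mul1r. Qed.

Lemma ip_eq0 u : (ip u u == 0) = (u == 0).
Proof.
have [->|u0] := eqVneq u 0; first by rewrite linear0r eqxx.
by apply/negbTE; rewrite gt_eqF// neq0_dnorm_gt0.
Qed.

Lemma ip_ge0 u : 0 <= ip u u.
Proof.
have [->|u0] := eqVneq u 0; first by rewrite linear0r.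
by rewrite ltW// neq0_dnorm_gt0.
Qed.

Lemma norm2_sqr u : norm2 u ^+ 2 = ip u u.
Proof. by rewrite sqr_sqrtr// ip_ge0. Qed.

Lemma rieszE u v : riesz u v = ip u v.
Proof.
have phiE w : linfun (fun v : H => ip w v : R^o) =1 ip w.
  by apply: linfunE => a x y; rewrite linearPr.
rewrite linfunE ?phiE// => a x y; apply/lfunP => z.
by rewrite add_lfunE scale_lfunE !phiE linearPl.
Qed.

Lemma lker_riesz : lker riesz == 0%VS.
Proof.
rewrite -subv0; apply/subvP => u; rewrite memv_ker memv0 => /eqP ru0.
by rewrite -ip_eq0 -rieszE ru0 zero_lfunE.
Qed.

Lemma rieszK : cancel riesz riesz_inv.
Proof. by move=> u; rewrite /riesz_inv lker0_lfunK // lker_riesz. Qed.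

Lemma limg_riesz : limg riesz = fullv.
Proof.
apply/eqP; rewrite eqEdim subvf /= limg_dim_eq; last first.
  by rewrite (eqP lker_riesz) capv0.
by rewrite !dimvf /dim /= muln1.
Qed.

Lemma riesz_invK : cancel riesz_inv riesz.
Proof. by move=> l; rewrite limg_lfunVK // limg_riesz memvf. Qed.

Let ip_dual_bilinear : bilinear_for *%R (idfun \; *%R) ip_dual.
Proof.
split=> x a y z; first by rewrite /ip_dual linearP linearPl.
by rewrite /ip_dual linearP linearPr.
Qed.

HB.instance Definition _ :=
  bilinear_isBilinear.Build R _ _ R *%R (idfun \; *%R) ip_dual ip_dual_bilinear.

Let ip_dualC x y : ip_dual x y = (-1) ^+ false * idfun (ip_dual y x).
Proof. by rewrite /ip_dual expr0 mul1r ipC. Qed.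

HB.instance Definition _ :=
  @isHermitianSesquilinear.Build R _ false idfun ip_dual ip_dualC.

Let ip_dual_gt0 l : l != 0 -> 0 < ip_dual l l.
Proof.
move=> l0; apply: neq0_dnorm_gt0; apply: contra_neq l0 => l0.
by rewrite -[l]riesz_invK l0 linear0.
Qed.

HB.instance Definition _ := @isDotProduct.Build R _ ip_dual ip_dual_gt0.

End Euclidean.

Section RealLine.
Variable R : rcfType.

Definition ip_real (x y : R^o) : R := x * y.

Let bil : bilinear_for *%R (idfun \; *%R) ip_real.
Proof.
split=> x a y z; first by rewrite /ip_real mulrDl -mulrA.
by rewrite /ip_real mulrDr mulrCA.
Qed.

HB.instance Definition _ :=
  bilinear_isBilinear.Build R _ _ R *%R (idfun \; *%R) ip_real bil.

Let herm x y : ip_real x y = (-1) ^+ false * idfun (ip_real y x).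
Proof. by rewrite expr0 mul1r [LHS]mulrC. Qed.

HB.instance Definition _ :=
  @isHermitianSesquilinear.Build R _ false idfun ip_real herm.

Let pos x : x != 0 -> 0 < ip_real x x.
Proof. by move=> x0; rewrite /ip_real -expr2 exprn_even_gt0. Qed.

HB.instance Definition _ := @isDotProduct.Build R _ ip_real pos.

End RealLine.

Section Functions.
Variables (R : rcfType) (I : finType) (H : vectType R) (ip : {dot H for idfun}).

Definition ip_ffun (u v : {ffun I -> H}) : R := \sum_i ip (u i) (v i).

Let bil : bilinear_for *%R (idfun \; *%R) ip_ffun.
Proof.
split=> x a y z; rewrite /ip_ffun /= mulr_sumr -big_split /=;
  apply: eq_bigr => i _; rewrite !ffunE ?linearPl //.
by rewrite linearPr.
Qed.

HB.instance Definition _ :=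
  bilinear_isBilinear.Build R _ _ R *%R (idfun \; *%R) ip_ffun bil.

Let herm x y : ip_ffun x y = (-1) ^+ false * idfun (ip_ffun y x).
Proof.
by rewrite expr0 mul1r; apply: eq_bigr => i _; rewrite ipC.
Qed.

HB.instance Definition _ :=
  @isHermitianSesquilinear.Build R _ false idfun ip_ffun herm.

Let pos x : x != 0 -> 0 < ip_ffun x x.
Proof.
move=> x0; rewrite lt_neqAle sumr_ge0 ?andbT => [|i _]; last exact: ip_ge0.
apply: contra_neq x0 => /esym/eqP; rewrite psumr_eq0 => [/allP s0|i _]; last first.
  exact: ip_ge0.
apply/ffunP => i; rewrite ffunE; apply/eqP.
by have := s0 i (mem_index_enum i); rewrite /= ip_eq0.
Qed.

HB.instance Definition _ := @isDotProduct.Build R _ ip_ffun pos.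

End Functions.

Section Subspaces.
Variables (R : rcfType) (H : vectType R) (W : {vspace H}).
Variable ip : {dot H for idfun}.

Definition ip_sub (u v : subvs_of W) : R := ip (vsval u) (vsval v).

Let bil : bilinear_for *%R (idfun \; *%R) ip_sub.
Proof.
by split=> x a y z; rewrite /ip_sub linearP ?linearPl// linearPr.
Qed.

HB.instance Definition _ :=
  bilinear_isBilinear.Build R _ _ R *%R (idfun \; *%R) ip_sub bil.

Let herm x y : ip_sub x y = (-1) ^+ false * idfun (ip_sub y x).
Proof. by rewrite expr0 mul1r /ip_sub ipC. Qed.

HB.instance Definition _ :=
  @isHermitianSesquilinear.Build R _ false idfun ip_sub herm.

Let pos x : x != 0 -> 0 < ip_sub x x.
Proof.
by move=> x0; apply: neq0_dnorm_gt0; apply: contra_neq x0 => x0; apply/val_inj.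
Qed.

HB.instance Definition _ := @isDotProduct.Build R _ ip_sub pos.

End Subspaces.

Section OrthogonalProjection.
Variables (R : rcfType) (H : vectType R) (ip : {dot H for idfun}).
Variable W : {vspace H}.

Lemma orthov_disjoint : (W :&: orthov ip W = 0)%VS.
Proof.
apply/eqP; rewrite -subv0; apply/subvP => u; rewrite memv_cap => /andP[uW].
by move=> /mem_orthovP /(_ _ uW) /eqP; rewrite ip_eq0 memv0.
Qed.

Lemma orthov_sum : (W + orthov ip W = fullv)%VS.
Proof.
apply/eqP; rewrite eqEsubv subvf /=; apply/subvP => u _.
pose l := (riesz ip u \o linfun (@vsval _ _ W))%VF.
pose w := riesz_inv (ip_sub (W := W) ip) l.
rewrite -[u](subrKC (vsval w)); apply: memv_add; first exact: subvsP.
apply/mem_orthovP => v vW; rewrite linearBl /=; apply/eqP; rewrite subr_eq0.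
have : riesz (ip_sub (W := W) ip) w (vsproj W v) = l (vsproj W v).
  by rewrite riesz_invK.
by rewrite rieszE comp_lfunE lfunE /= rieszE /ip_sub /= vsprojK// => ->.
Qed.

Lemma orth_projP u :
  orth_proj ip W u \in W /\ u - orth_proj ip W u \in orthov ip W.
Proof.
split; first exact: memv_pi.
have uWW : u \in (W + orthov ip W)%VS by rewrite orthov_sum memvf.
by rewrite -{1}(daddv_pi_add orthov_disjoint uWW) addrC addKr memv_pi.
Qed.

End OrthogonalProjection.

Section Spaces.
Variables (R : rcfType) (P : finType) (K : nat) (D : 'I_K -> {set P}).

Local Notation V := {ffun P -> R^o}.

(* Functions supported in [A], see [supp_vsP]. *)
Definition supp_vs (A : {set P}) : {vspace V} :=
  (\bigcap_(p | p \notin A) lker (linfun (fun v : V => v p)))%VS.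

(* The external direct sum of the [supp_vs (D s)] is realised as the space of
   families [w] with [w s \in supp_vs (D s)] for all [s], see [ext_vsP]. *)
Definition ext_vs : {vspace {ffun 'I_K -> V}} :=
  (\bigcap_s (linfun (fun w : {ffun 'I_K -> V} => w s) @^-1: supp_vs (D s)))%VS.

Local Notation Vloc s := (subvs_of (supp_vs (D s))).
Local Notation Vext := (subvs_of ext_vs).

Lemma supp_vsP (A : {set P}) (v : V) :
  (v \in supp_vs A) = (0.-support v \subset A).
Proof.
have evE p : linfun (fun v : V => v p) v = v p.
  by apply: linfunE => a x y; rewrite !ffunE.
apply/idP/fintype.subsetP => [vA p|vA].
  rewrite inE; apply: contraR => pA; rewrite -evE.
  rewrite -memv_ker; move: (v) (vA); apply/subvP.
  exact: (@bigcapv_inf _ _ _ p).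
rewrite memvE; apply/subv_bigcapP => p pA; rewrite -memvE memv_ker evE.
by apply: contraR pA => vp; apply: vA.
Qed.

Lemma ext_vsP (w : {ffun 'I_K -> V}) :
  reflect (forall s, w s \in supp_vs (D s)) (w \in ext_vs).
Proof.
have evE s : linfun (fun w : {ffun 'I_K -> V} => w s) w = w s.
  by apply: linfunE => a x y; rewrite !ffunE.
apply: (iffP idP) => [wD s|wD].
  rewrite -evE memv_preim; move: (w) (wD); apply/subvP.
  exact: (@bigcapv_inf _ _ _ s).
rewrite memvE; apply/subv_bigcapP => s _.
by rewrite -memvE -memv_preim evE.
Qed.

Definition ip_loc s : {dot (Vloc s) for idfun} :=
  @ip_sub R V (supp_vs (D s)) (@ip_ffun R P R^o (@ip_real R)).

Definition ip_ext : {dot Vext for idfun} :=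
  @ip_sub R {ffun 'I_K -> V} ext_vs
    (@ip_ffun R 'I_K V (@ip_ffun R P R^o (@ip_real R))).

Definition ext_comp s (u : Vext) : Vloc s :=
  Subvs (elimT (ext_vsP (vsval u)) (subvsP u) s).

Lemma ext_inj_subproof s (v : Vloc s) :
  [ffun t => if t == s then vsval v else 0] \in ext_vs.
Proof.
apply/ext_vsP => t; rewrite ffunE.
by case: eqP => [->|_]; [exact: subvsP | exact: mem0v].
Qed.

Definition ext_inj s (v : Vloc s) : Vext := Subvs (ext_inj_subproof v).

(* The [s]-component of a functional is its restriction to the [s]-th
   summand, see [comp_dualE]. *)
Definition comp_dual s (l : 'Hom(Vext, R^o)) : 'Hom(Vloc s, R^o) :=
  (l \o linfun (@ext_inj s))%VF.

Lemma comp_dualE s l v : comp_dual s l v = l (ext_inj v).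
Proof.
rewrite comp_lfunE /= linfunE// => a x y; apply/val_inj/ffunP => t /=.
by rewrite !ffunE; case: eqP => _ //; rewrite scaler0 addr0.
Qed.

(* The family, over [s < t], of functions on [D s :&: D t] is flattened into
   one function on the triples [(s, t, p)] with [p \in D s :&: D t]. *)
Definition jump_index :=
  {x : 'I_K * 'I_K * P |
    (x.1.1 < x.1.2)%N && (x.2 \in D x.1.1 :&: D x.1.2)}.

Definition jump : 'Hom(Vext, {ffun jump_index -> R^o}) :=
  linfun (fun u : Vext => [ffun x : jump_index =>
    let: (s, t, p) := val x in vsval (ext_comp s u) p - vsval (ext_comp t u) p]
    : {ffun jump_index -> R^o}).

Lemma jumpE u (x : jump_index) :
  jump u x = vsval (ext_comp (val x).1.1 u) (val x).2
             - vsval (ext_comp (val x).1.2 u) (val x).2.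
Proof.
rewrite linfunE => [|a v w]; last first.
  apply/ffunP => y; rewrite !ffunE; case: (val y) => [[s t] p] /=.
  by rewrite !ffunE scalerBr opprD !addrA; congr (_ - _); rewrite addrAC.
by rewrite ffunE; case: (val x) => [[s t] p].
Qed.

Definition PB : 'End(Vext) := orth_proj ip_ext (lker jump).

Definition IPB : 'End(Vext) := \1%VF - PB.

End Spaces.

Definition is_argmin (R : numDomainType) (U : Type) (f : U -> R) (x : U) :=
  forall y, f x <= f y.

Definition rect_partition (M N K : nat) (Om : 'I_K -> {set 'I_M * 'I_N}) :=
  [/\ forall s, exists a b : 'I_M, exists c d : 'I_N,
        [/\ (a <= b)%N, (c <= d)%N &
         Om s = [set p : 'I_M * 'I_N | (a <= p.1 <= b)%N && (c <= p.2 <= d)%N]],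
      forall s t, s != t -> [disjoint Om s & Om t] &
      (\bigcup_s Om s)%SET = [set: 'I_M * 'I_N]%SET].

Section Method.
Variables (R : realType) (P : finType).

Local Notation V := {ffun P -> R^o}.

Variable T : V -> V.

Definition depends_on (A B : {set P}) : Prop :=
  forall u v : V, {in B, u =1 v} -> {in A, T u =1 T v}.

Lemma depends_on_setT A : `[< depends_on A [set: P]%SET >].
Proof.
by apply/asboolP => u v uv p _; congr (T _ p); apply/ffunP => q; apply: uv.
Qed.

Definition ess_dom (A : {set P}) : {set P} :=
  s2val (minset_exists (P := fun B => `[< depends_on A B >])
           (depends_on_setT A)).

Lemma ess_domP A : depends_on A (ess_dom A).
Proof.
by rewrite /ess_dom; case: minset_exists => B /= /minsetP[/asboolP].
Qed.

(* The minimal set is unique, so the choice made by [minset_exists] in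
   [ess_dom] is immaterial. *)
Lemma ess_dom_sub A B : depends_on A B -> ess_dom A \subset B.
Proof.
move=> AB; rewrite /ess_dom; case: minset_exists => C /= /minsetP[/asboolP AC].
move=> minC _; rewrite -(minC (C :&: B)) ?subsetIl ?subsetIr//.
apply/asboolP => u v uv p pA.
pose w : V := [ffun q => if q \in C then u q else v q].
rewrite (AC u w) => [|q qC|//]; last by rewrite ffunE qC.
apply: AB => // q qB; rewrite ffunE; case: ifPn => // qC.
by apply: uv; rewrite inE qC.
Qed.

Variables (K : nat) (Om : 'I_K -> {set P}).

Definition tOm s : {set P} := ess_dom (Om s).

Local Notation Vloc s := (subvs_of (supp_vs R (tOm s))).
Local Notation Vext := (subvs_of (ext_vs R tOm)).

Definition energy s (u : V) : R := \sum_(p in Om s) T u p.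

Definition tenergy (u : Vext) : R := \sum_s energy s (vsval (ext_comp s u)).

Definition u_hat (eta : R) s (u : Vext) (l : 'Hom(Vext, R^o)) : Vloc s :=
  ext_comp s (PB R tOm u) - eta^-1 *: riesz_inv (ip_loc R tOm s) (comp_dual s l).

Record dec_aug_lagrangian (eta : R) (u : nat -> Vext)
    (l : nat -> 'Hom(Vext, R^o)) : Prop := {
  dal_init : riesz_inv (ip_ext R tOm) (l 0%N)
               \in orthov (ip_ext R tOm) (lker (jump R tOm));
  dal_primal : forall n s,
    is_argmin (fun v : Vloc s => energy s (vsval v) + eta / 2 *
        norm2 (ip_loc R tOm s) (v - u_hat eta s (u n) (l n)) ^+ 2)
      (ext_comp s (u n.+1));
  dal_dual : forall n,
    l n.+1 = l n + eta *: riesz (ip_ext R tOm) (IPB R tOm (u n.+1)) }.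

Definition aug_lagrangian (eta : R) (u : Vext) (l : 'Hom(Vext, R^o)) : R :=
  tenergy u
  + ip_dual (ip_ext R tOm) (riesz (ip_ext R tOm) (IPB R tOm u)) l
  + eta / 2 * norm2 (ip_ext R tOm) (IPB R tOm u) ^+ 2.

Definition critical_point (eta : R) (u : Vext) (l : 'Hom(Vext, R^o)) : Prop :=
  IPB R tOm u = 0 /\ is_argmin (aug_lagrangian eta ^~ l) u.

End Method.

Arguments depends_on {R P} T A B.
Arguments ess_dom {R P} T A.
Arguments tOm {R P} T {K} Om s.
Arguments energy {R P} T {K} Om s u.
Arguments tenergy {R P} T {K} Om u.
Arguments u_hat {R P} T {K} Om eta s u l.
Arguments dec_aug_lagrangian {R P} T {K} Om eta u l.
Arguments aug_lagrangian {R P} T {K} Om eta u l.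
Arguments critical_point {R P} T {K} Om eta u l.

(* Main.v *)
Require Import Defs.
From mathcomp Require Import all_boot all_order all_algebra.
From mathcomp Require Import all_classical all_reals all_analysis.
From mathcomp Require Import ring lra.

(** The method is Douglas-Rachford splitting in disguise.  Write [P] for the
    orthogonal projection onto the kernel [W] of the jump operator, and identify
    the multipliers [l n] with vectors [m n] through the Riesz isomorphism; they
    all lie in the orthogonal complement of [W].  The single state
    [x n = P (u n) - eta^-1 *: m n] carries both, and because its two parts are
    orthogonal, the left-hand side of the estimate is exactly the squared length
    of [x n - x n.+1] ([sqr_dr_state]).

    The local problems together form one proximal step of the total energy from
    [x n] ([local_steps_argmin]), so that [eta *: (x n - u n.+1)] is a
    subgradient at [u n.+1] ([prox_subgradient]), and the multiplier update reads
    [x n.+1 = P (u n.+1) + (1 - P) (x n - u n.+1)] ([dr_stateP]).  Subgradients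
    of a function are monotone, which makes the map from [x n] to [x n.+1] firmly
    nonexpansive ([dr_step_nonexpansive]).  A critical point [(us, ms)] yields
    the fixed point [us - eta^-1 *: (ms - P ms)] ([dr_fixpointP]).

    For a firmly nonexpansive iteration, the squared increments sum to at most
    the squared initial distance to a fixed point, and they do not increase; so
    the [n]-th one is at most the average of the first [n + 1]
    ([fejer_rate]).  The component of [ms] along [W] only increases the distance
    that appears on the right ([sqr_dr_fixpoint_le]), so the bound holds for each
    critical point and therefore for the infimum. *)

Set Implicit Arguments.
Unset Strict Implicit.
Unset Printing Implicit Defensive.

Import Order.TTheory GRing.Theory Num.Theory.

Local Open Scope classical_set_scope.
Local Open Scope ring_scope.

(** * Subgradients and minimizers of convex functions *)

Lemma ge0_of_small_perturb (R : realFieldType) (a c : R) :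
  (forall t, 0 < t -> t <= 1 -> 0 <= a + t * c) -> 0 <= a.
Proof.
move=> ac; rewrite leNgt; apply/negP => a0.
(* At [t = - a / (`|c| - a)] a negative [a] would make [a + t * c] negative. *)
have d0 : 0 < `|c| - a by rewrite subr_gt0 (lt_le_trans a0).
have t0 : 0 < - a / (`|c| - a) by rewrite divr_gt0 ?oppr_gt0.
have t1 : - a / (`|c| - a) <= 1 by rewrite ler_pdivrMr// mul1r lerDr.
have := ac _ t0 t1; rewrite leNgt => /negP; apply.
rewrite -ltrBrDl sub0r; apply: (@le_lt_trans _ _ (- a / (`|c| - a) * `|c|)).
  by rewrite ler_pM2l// ler_norm.
by rewrite mulrAC ltr_pdivrMr// ltr_pM2l ?oppr_gt0// ltrDl oppr_gt0.
Qed.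

Section EuclideanConvexity.
Variables (R : rcfType) (H : vectType R) (ip : {dot H for idfun}).
Implicit Types (u v x y g : H) (f : H -> R).

Definition subgradient f u g := forall v, f u + ip g (v - u) <= f v.

Lemma ipDl u v x : ip (u + v) x = ip u x + ip v x. Proof. exact: linearDl. Qed.
Lemma ipDr u v x : ip x (u + v) = ip x u + ip x v. Proof. exact: linearDr. Qed.
Lemma ipNl u x : ip (- u) x = - ip u x. Proof. exact: linearNl. Qed.
Lemma ipNr u x : ip x (- u) = - ip x u. Proof. exact: linearNr. Qed.
Lemma ipBl u v x : ip (u - v) x = ip u x - ip v x. Proof. exact: linearBl. Qed.
Lemma ipBr u v x : ip x (u - v) = ip x u - ip x v. Proof. exact: linearBr. Qed.
Lemma ipZl a u x : ip (a *: u) x = a * ip u x. Proof. exact: linearZl_LR. Qed.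
Lemma ipZr a u x : ip x (a *: u) = a * ip x u. Proof. by rewrite linearZr. Qed.

Lemma subgradient_monotone f u v g h :
  subgradient f u g -> subgradient f v h -> 0 <= ip (u - v) (g - h).
Proof.
move=> /(_ v) + /(_ u).
by rewrite !(ipBl, ipBr) !(ipC ip _ g) !(ipC ip _ h); lra.
Qed.

(** First-order optimality for [f + q] with [f] convex and [q] a quadratic
    perturbation whose gradient at [u] is [- g].  Along the segment from [u] to
    [v], convexity bounds the increase of [f] by [t * (f v - f u)]; dividing by
    [t] and letting [t] tend to 0 removes the second-order part [c]. *)
Lemma convex_min_subgradient f q u g (c : H -> R) :
  convex_function [set: convex_lmodType H] f ->
  (forall v, f u + q u <= f v + q v) ->
  (forall d t, q (u + t *: d) = q u - t * ip g d + t ^+ 2 * c d) ->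
  subgradient f u g.
Proof.
move=> cf umin qE v; rewrite -subr_ge0.
apply: (@ge0_of_small_perturb _ _ (c (v - u))) => t t0 t1.
have fc : f (t *: v + (1 - t) *: u) <= t * f v + (1 - t) * f u.
  by apply: (cf (Itv01 (ltW t0) t1)); rewrite inE.
have := umin (u + t *: (v - u)); rewrite qE.
have -> : u + t *: (v - u) = t *: v + (1 - t) *: u.
  by rewrite scalerBr scalerBl scale1r addrCA.
move=> uc; rewrite -(pmulr_rge0 _ t0).
lra.
Qed.

Lemma prox_subgradient f (eta : R) u x :
  convex_function [set: convex_lmodType H] f ->
  is_argmin (fun v => f v + eta / 2 * norm2 ip (v - x) ^+ 2) u ->
  subgradient f u (eta *: (x - u)).
Proof.
move=> cf umin; apply: (@convex_min_subgradient f
  (fun v => eta / 2 * norm2 ip (v - x) ^+ 2) u _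
  (fun d => eta / 2 * ip d d)) => // d t.
rewrite (addrAC u) -(opprB u x) !norm2_sqr; move: (u - x) => e.
rewrite !(ipDl, ipDr, ipZl, ipZr, ipNl) (ipC ip d e).
by field.
Qed.

End EuclideanConvexity.

(** * Orthogonal projections *)

Section DouglasRachford.
Variables (R : rcfType) (H : vectType R) (ip : {dot H for idfun}).
Variable W : {vspace H}.
Implicit Types (u v x y z : H) (f : H -> R).
Local Notation P := (orth_proj ip W).

Lemma orth_proj_perp u v : ip (P u) (v - P v) = 0.
Proof.
have [Pu _] := orth_projP ip W u; have [_ Qv] := orth_projP ip W v.
by rewrite ipC; apply: (mem_orthovP Qv).
Qed.

Lemma orth_proj_unique u w :
  w \in W -> u - w \in orthov ip W -> P u = w.
Proof.
move=> wW uw; have [PuW uPu] := orth_projP ip W u.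
apply/eqP; rewrite -subr_eq0 -memv0 -(orthov_disjoint ip W) memv_cap.
rewrite memvB//=; have -> : P u - w = (u - w) - (u - P u).
  by rewrite opprB [RHS]addrC subrKA.
exact: memvB.
Qed.

Lemma orth_projK u : P (P u) = P u.
Proof.
have [PuW _] := orth_projP ip W u.
by apply: orth_proj_unique; rewrite // subrr mem0v.
Qed.

Lemma orth_proj_orthov u : u \in orthov ip W -> P u = 0.
Proof. by move=> uW; apply: orth_proj_unique; rewrite ?mem0v ?subr0. Qed.

Lemma orth_proj_sym u v : ip (P u) v = ip u (P v).
Proof.
have := orth_proj_perp u v; rewrite ipBr => /eqP; rewrite subr_eq0 => /eqP ->.
have := orth_proj_perp v u; rewrite ipC ipBl => /eqP; rewrite subr_eq0 => /eqP.
by move=> ->.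
Qed.

Lemma orth_proj_pythagoras u : ip u u = ip (P u) (P u) + ip (u - P u) (u - P u).
Proof.
have := orth_proj_perp u u.
by rewrite !(ipBl, ipBr) (ipC ip u (P u)); lra.
Qed.

(** * Firm nonexpansiveness and the O(1/n) rate *)

(** With [j] the difference of two proximal points and [d] that of their
    arguments, [d'] is the difference of the resulting states.  The defect in the
    inequality is [2 * ip d' (d - d')], and the projection splits
    [ip d' (d - d')] into [ip (P j) (P e) + ip (e - P e) (j - P j) = ip j e] for
    [e = d - j]. *)
Lemma dr_step_firm d j (d' := P j + (d - j - P (d - j))) : 0 <= ip j (d - j) ->
  ip d' d' + ip (d - d') (d - d') <= ip d d.
Proof.
have -> : ip d d = ip d' d' + ip (d - d') (d - d') + 2 * ip d' (d - d').
  by rewrite !(ipBl, ipBr) (ipC ip d d'); ring.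
suff -> : ip d' (d - d') = ip j (d - j) by lra.
rewrite /d'; have -> : d - (P j + (d - j - P (d - j))) = j - P j + P (d - j).
  by rewrite -{1}[d](subrKC j) opprD opprB addrACA subrKC.
move: (d - j) => e.
rewrite !(ipDl, ipDr, ipNl, ipNr) !orth_proj_sym !orth_projK.
by rewrite (ipC ip e j) (ipC ip e (P j)) orth_proj_sym; ring.
Qed.

(** The first hypothesis telescopes to a bound on the sum of the squared
    increments; by the second one the last of them is the smallest.  The
    induction needs the distance from [x n.+1] to [z] kept on the left. *)
Lemma fejer_rate (x : nat -> H) z n :
  (forall k, ip (x k.+1 - z) (x k.+1 - z) + ip (x k - x k.+1) (x k - x k.+1)
             <= ip (x k - z) (x k - z)) ->
  (forall k, ip (x k.+1 - x k.+2) (x k.+1 - x k.+2)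
             <= ip (x k - x k.+1) (x k - x k.+1)) ->
  n.+1%:R * ip (x n - x n.+1) (x n - x n.+1) <= ip (x 0%N - z) (x 0%N - z).
Proof.
move=> fejer decr.
suff : n.+1%:R * ip (x n - x n.+1) (x n - x n.+1) + ip (x n.+1 - z) (x n.+1 - z)
    <= ip (x 0%N - z) (x 0%N - z).
  by have := ip_ge0 ip (x n.+1 - z); lra.
elim: n => [|n IHn]; first by rewrite mul1r addrC.
have := fejer n.+1; have : n.+1%:R * ip (x n.+1 - x n.+2) (x n.+1 - x n.+2)
    <= n.+1%:R * ip (x n - x n.+1) (x n - x n.+1) by rewrite ler_wpM2l.
rewrite -[n.+2%:R]natr1; lra.
Qed.

(** One Douglas-Rachford step from [x] to [y] through the point [u], the
    resolvent at [x] of the subdifferential of [f] scaled by [eta^-1].  As a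
    relation it covers the iterates and the fixed points alike, without choosing
    a minimizer. *)
Definition dr_step f (eta : R) x u y :=
  subgradient ip f u (eta *: (x - u)) /\ y = P u + (x - u - P (x - u)).

Lemma dr_step_nonexpansive f (eta : R) x u y x' u' y' : 0 < eta ->
  dr_step f eta x u y -> dr_step f eta x' u' y' ->
  ip (y - y') (y - y') + ip (x - x' - (y - y')) (x - x' - (y - y'))
    <= ip (x - x') (x - x').
Proof.
move=> eta0 [xu ->] [xu' ->].
have := subgradient_monotone xu xu'; rewrite -scalerBr ipZr pmulr_rge0//.
have xuE : x - u - (x' - u') = (x - x') - (u - u') by rewrite !opprD addrACA.
rewrite xuE => /dr_step_firm /=; rewrite -xuE.
suff <- : P u + (x - u - P (x - u)) - (P u' + (x' - u' - P (x' - u'))) =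
  P (u - u') + (x - u - (x' - u') - P (x - u - (x' - u'))) by [].
rewrite [P (u - u')]linearB [P (_ - (x' - u'))]linearB.
by rewrite opprD addrACA; congr (_ + _); rewrite !(opprD _ (- P _)) addrACA.
Qed.

(** * The augmented Lagrangian iteration as a Douglas-Rachford iteration *)

Section AugmentedLagrangian.
Variables (f : H -> R) (eta : R).
Hypotheses (f_convex : convex_function [set: convex_lmodType H] f)
           (eta_gt0 : 0 < eta).

(** The augmentation term vanishes to second order at [u], since [u] lies in
    [W]; only the multiplier contributes to the optimality condition. *)
Lemma saddle_subgradient u m : P u = u ->
  is_argmin (fun v => f v + ip (v - P v) m +
                      eta / 2 * norm2 ip (v - P v) ^+ 2) u ->
  subgradient ip f u (P m - m).
Proof.
move=> Pu umin.
pose q v := eta / 2 * norm2 ip (v - P v) ^+ 2 + ip (v - P v) m.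
apply: (@convex_min_subgradient _ _ ip f q u _
  (fun d => eta / 2 * ip (d - P d) (d - P d))) => // [v|d t].
  by rewrite /q ![f _ + _]addrCA ![_ + (f _ + _)]addrC; apply: umin.
have qE v : q v = eta / 2 * ip (v - P v) (v - P v) + ip (v - P v) m.
  by rewrite /q norm2_sqr.
have Pud : P (u + t *: d) = u + t *: P d by rewrite linearD linearZ /= Pu.
rewrite !qE Pud Pu subrr.
have -> : u + t *: d - (u + t *: P d) = t *: (d - P d).
  by rewrite opprD addrACA subrr add0r scalerBr.
have -> : ip (P m - m) d = - ip (d - P d) m.
  by rewrite !ipBl orth_proj_sym (ipC ip m (P d)) (ipC ip m d) opprB.
by rewrite !(ipZl, ipZr) !linear0l; ring.
Qed.

(** A saddle point determines its multiplier only modulo [W], whereas the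
    multipliers of the iteration are orthogonal to [W]; hence the component of
    [m] along [W] is taken out. *)
Definition dr_fixpoint u m := u - eta^-1 *: (m - P m).

Lemma dr_fixpointP u m : P u = u ->
  is_argmin (fun v => f v + ip (v - P v) m +
                      eta / 2 * norm2 ip (v - P v) ^+ 2) u ->
  dr_step f eta (dr_fixpoint u m) u (dr_fixpoint u m).
Proof.
move=> Pu umin; rewrite /dr_step /dr_fixpoint.
have -> : u - eta^-1 *: (m - P m) - u = eta^-1 *: (P m - m).
  by rewrite addrAC subrr add0r -scalerN opprB.
split.
  by rewrite scalerA divff ?gt_eqF// scale1r; apply: saddle_subgradient.
have -> : P (eta^-1 *: (P m - m)) = 0.
  by rewrite linearZ linearB /= orth_projK subrr scaler0.
by rewrite Pu subr0 -scalerN opprB.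
Qed.

Definition dr_state u m := P u - eta^-1 *: m.

Lemma dr_stateP u m u' : P m = 0 ->
  is_argmin (fun v => f v + eta / 2 * norm2 ip (v - dr_state u m) ^+ 2) u' ->
  dr_step f eta (dr_state u m) u' (dr_state u' (m + eta *: (u' - P u'))).
Proof.
move=> Pm umin; split; first exact: prox_subgradient.
rewrite /dr_state scalerDr scalerA mulVf ?gt_eqF// scale1r.
have -> : P (P u - eta^-1 *: m - u') = P u - P u'.
  by rewrite !linearB linearZ /= Pm scaler0 subr0 orth_projK.
congr (_ + _); rewrite opprD opprB addrCA opprB [RHS]addrC -!addrA.
by rewrite addKr.
Qed.

Lemma sqr_dr_state u m u' m' : P m = 0 -> P m' = 0 ->
  ip (dr_state u m - dr_state u' m') (dr_state u m - dr_state u' m') =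
  norm2 ip (P (u - u')) ^+ 2 + 1 / eta ^+ 2 * norm2 ip (m - m') ^+ 2.
Proof.
move=> Pm Pm'; have Pmm : P (m - m') = 0 by rewrite linearB /= Pm Pm' subrr.
have -> : dr_state u m - dr_state u' m' = P (u - u') - eta^-1 *: (m - m').
  by rewrite [P (u - u')]linearB /dr_state scalerBr !opprD addrACA opprK.
rewrite !norm2_sqr; move: (m - m') (u - u') Pmm => e d Pe.
have Pde : ip (P d) e = 0 by rewrite orth_proj_sym Pe linear0r.
rewrite !(ipDl, ipDr, ipNl, ipNr, ipZl, ipZr) (ipC ip e) Pde.
by field; rewrite gt_eqF.
Qed.

Lemma sqr_dr_fixpoint_le u m u' m' : P m = 0 -> P u' = u' ->
  ip (dr_state u m - dr_fixpoint u' m') (dr_state u m - dr_fixpoint u' m') <=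
  norm2 ip (P (u - u')) ^+ 2 + 1 / eta ^+ 2 * norm2 ip (m - m') ^+ 2.
Proof.
move=> Pm Pu'.
have -> : dr_fixpoint u' m' = dr_state u' (m' - P m').
  by rewrite /dr_state Pu'.
rewrite sqr_dr_state ?Pm//; last by rewrite linearB /= orth_projK subrr.
rewrite lerD2l ler_wpM2l ?divr_ge0 ?exprn_ge0 ?(ltW eta_gt0)//.
rewrite !norm2_sqr [leRHS]orth_proj_pythagoras.
have -> : m - m' - P (m - m') = m - (m' - P m').
  by rewrite linearB /= Pm sub0r opprK opprB addrA addrAC.
by rewrite lerDr ip_ge0.
Qed.

(** The rate for the undecoupled method on an arbitrary Euclidean space, with
    the constraint [u \in W] and the multipliers represented by vectors. *)
Theorem aug_lagrangian_rate (u m : nat -> H) us ms n :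
  P (m 0%N) = 0 ->
  (forall k, is_argmin (fun v => f v +
     eta / 2 * norm2 ip (v - (P (u k) - eta^-1 *: m k)) ^+ 2) (u k.+1)) ->
  (forall k, m k.+1 = m k + eta *: (u k.+1 - P (u k.+1))) ->
  P us = us ->
  is_argmin (fun v => f v + ip (v - P v) ms +
                      eta / 2 * norm2 ip (v - P v) ^+ 2) us ->
  n.+1%:R * (norm2 ip (P (u n - u n.+1)) ^+ 2 +
             1 / eta ^+ 2 * norm2 ip (m n - m n.+1) ^+ 2)
  <= norm2 ip (P (u 0%N - us)) ^+ 2 + 1 / eta ^+ 2 * norm2 ip (m 0%N - ms) ^+ 2.
Proof.
move=> Pm0 umin mS Pus usmin.
have Pm k : P (m k) = 0.
  elim: k => [//|k IHk].
  by rewrite mS linearD linearZ linearB /= orth_projK subrr scaler0 addr0.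
pose x k := dr_state (u k) (m k).
have xS k : dr_step f eta (x k) (u k.+1) (x k.+1).
  by rewrite /x mS; apply: dr_stateP => //; apply: umin.
have zz := dr_fixpointP Pus usmin.
rewrite -sqr_dr_state//.
apply: le_trans (sqr_dr_fixpoint_le (u 0%N) ms (Pm 0%N) Pus).
apply: (fejer_rate (x := x)) => k.
  have := dr_step_nonexpansive eta_gt0 (xS k) zz.
  by rewrite (opprB (x k.+1)) subrKA.
apply: le_trans (dr_step_nonexpansive eta_gt0 (xS k) (xS k.+1)).
by rewrite lerDl ip_ge0.
Qed.

End AugmentedLagrangian.

End DouglasRachford.

(** * Decoupling over the subdomains *)

Section Method.
Variables (R : realType) (Q : finType) (K : nat).
Local Notation V := {ffun Q -> R^o}.
Variables (T : V -> V) (Om : 'I_K -> {set Q}).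
Local Notation D := (tOm T Om).
Local Notation Vext := (subvs_of (ext_vs R D)).
Local Notation ip := (ip_ext R D).
Local Notation P := (PB R D).
Local Notation kerB := (lker (jump R D)).
Local Notation E := (tenergy T Om).
Implicit Types (u v : Vext) (l : 'Hom(Vext, R^o)).

Lemma ip_ext_inj s u (v : subvs_of (supp_vs R (D s))) :
  ip u (ext_inj v) = ip_loc R D s (ext_comp s u) v.
Proof.
rewrite /= /ip_sub /= /ip_ffun (bigD1 s)//= ffunE eqxx big1 ?addr0// => t ts.
by rewrite ffunE (negbTE ts) linear0r.
Qed.

(** Restricting a functional to a summand corresponds to taking a component of
    its Riesz vector, because [ext_inj] and [ext_comp] are adjoint. *)
Lemma riesz_inv_comp_dual s l :
  riesz_inv (ip_loc R D s) (comp_dual s l) = ext_comp s (riesz_inv ip l).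
Proof.
apply: (can_inj (rieszK (ip_loc R D s))); rewrite riesz_invK.
apply/lfunP => v; rewrite comp_dualE rieszE -ip_ext_inj -rieszE.
by rewrite riesz_invK.
Qed.

Lemma norm2_ext_sum u :
  norm2 ip u ^+ 2 = \sum_s norm2 (ip_loc R D s) (ext_comp s u) ^+ 2.
Proof. by rewrite norm2_sqr; apply: eq_bigr => s _; rewrite norm2_sqr. Qed.

Lemma u_hatE (eta : R) s u l :
  u_hat T Om eta s u l = ext_comp s (P u - eta^-1 *: riesz_inv ip l).
Proof.
rewrite /u_hat riesz_inv_comp_dual; apply/val_inj => /=.
by rewrite !ffunE.
Qed.

Lemma ext_compB s u v : ext_comp s (u - v) = ext_comp s u - ext_comp s v.
Proof. by apply/val_inj; rewrite /= !ffunE. Qed.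

(** The energy and the squared norm are sums over the subdomains of terms in
    the separate components, so minimizing each term minimizes the sum. *)
Lemma local_steps_argmin (eta : R) u l u' :
  (forall s, is_argmin (fun v : subvs_of (supp_vs R (D s)) =>
      energy T Om s (vsval v) + eta / 2 *
        norm2 (ip_loc R D s) (v - u_hat T Om eta s u l) ^+ 2)
    (ext_comp s u')) ->
  is_argmin (fun v => E v + eta / 2 *
      norm2 ip (v - (P u - eta^-1 *: riesz_inv ip l)) ^+ 2) u'.
Proof.
under [X in X -> _]eq_forall do rewrite u_hatE.
move: (P u - _) => x umin v.
have sumE w : E w + eta / 2 * norm2 ip (w - x) ^+ 2 =
    \sum_s (energy T Om s (vsval (ext_comp s w)) +
      eta / 2 * norm2 (ip_loc R D s) (ext_comp s w - ext_comp s x) ^+ 2).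
  rewrite big_split norm2_ext_sum mulr_sumr; congr (_ + _).
  by apply: eq_bigr => s _; rewrite ext_compB.
by rewrite !sumE; apply: ler_sum => s _; apply: umin.
Qed.

Lemma IPBE v : IPB R D v = v - P v.
Proof. by rewrite /IPB add_lfunE opp_lfunE id_lfunE. Qed.

Lemma aug_lagrangianE (eta : R) v l :
  aug_lagrangian T Om eta v l =
  E v + ip (v - P v) (riesz_inv ip l) + eta / 2 * norm2 ip (v - P v) ^+ 2.
Proof. by rewrite /aug_lagrangian /ip_dual rieszK IPBE. Qed.

Lemma dec_aug_lagrangian_rate (eta : R) (u : nat -> Vext)
    (l : nat -> 'Hom(Vext, R^o)) us ls n :
  0 < eta -> convex_function [set: convex_lmodType Vext] E ->
  dec_aug_lagrangian T Om eta u l -> critical_point T Om eta us ls ->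
  n.+1%:R * (norm2 ip (P (u n - u n.+1)) ^+ 2 +
             1 / eta ^+ 2 * norm2 (ip_dual ip) (l n - l n.+1) ^+ 2)
  <= norm2 ip (P (u 0%N - us)) ^+ 2 +
     1 / eta ^+ 2 * norm2 (ip_dual ip) (l 0%N - ls) ^+ 2.
Proof.
move=> eta0 cE [l0 umin lS] [Pus usmin].
have normE l1 l2 : norm2 (ip_dual ip) (l1 - l2) =
    norm2 ip (riesz_inv ip l1 - riesz_inv ip l2).
  by rewrite /norm2 /= /ip_dual linearB.
rewrite !normE.
apply: (aug_lagrangian_rate cE eta0 (m := fun k => riesz_inv ip (l k))
          (us := us) (ms := riesz_inv ip ls) (W := kerB)).
- exact: orth_proj_orthov.
- by move=> k; apply: local_steps_argmin => s; apply: umin.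
- by move=> k; rewrite lS linearD linearZ /= rieszK IPBE.
- by move/eqP: Pus; rewrite IPBE subr_eq0 => /eqP.
- move=> v; have := usmin v.
  by rewrite (aug_lagrangianE eta us ls) (aug_lagrangianE eta v ls).
Qed.

End Method.

Theorem theorem3p5 (R : realType) (M N K : nat)
    (T : {ffun 'I_M * 'I_N -> R^o} -> {ffun 'I_M * 'I_N -> R^o})
    (Om : 'I_K -> {set 'I_M * 'I_N})
    (Om_part : rect_partition Om)
    (Om_sub : forall s, Om s \subset tOm T Om s)
    (eta : R) (eta_gt0 : 0 < eta)
    (u : nat -> subvs_of (ext_vs R (tOm T Om)))
    (l : nat -> 'Hom(subvs_of (ext_vs R (tOm T Om)), R^o))
    (E_convex : convex_function
       [set: convex_lmodType (subvs_of (ext_vs R (tOm T Om)))]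
       (tenergy T Om))
    (ul_dal : dec_aug_lagrangian T Om eta u l)
    (n : nat) :
  ((norm2 (ip_ext R (tOm T Om)) (PB R (tOm T Om) (u n - u n.+1)) ^+ 2
    + 1 / eta ^+ 2 *
      norm2 (ip_dual (ip_ext R (tOm T Om))) (l n - l n.+1) ^+ 2)%:E
   <= (1 / n.+1%:R)%:E *
      ereal_inf [set (norm2 (ip_ext R (tOm T Om))
                        (PB R (tOm T Om) (u 0%N - c.1)) ^+ 2
                      + 1 / eta ^+ 2 *
                        norm2 (ip_dual (ip_ext R (tOm T Om)))
                          (l 0%N - c.2) ^+ 2)%:E
                | c in [set c | critical_point T Om eta c.1 c.2]])%E.
Proof.
rewrite [1 / n.+1%:R]div1r lee_pdivlMl ?ltr0n// -EFinM.
apply: le_ereal_inf_tmp => _ [[us ls] /= crit <-]; rewrite lee_fin.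
exact: dec_aug_lagrangian_rate.
Qed.
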